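(* If a forced derivation of the $\delta$-calculus in the empty context proves a closed formula $\varphi$, then $\mathfrak{N}\models\varphi$, where $\mathfrak{N}=(\mathbb{N},0,S,+,\cdot)$ is the standard model.
   Context: The ambient metatheory is intuitionistic (no excluded middle, LPO, Markov's principle or choice). The $\delta$-calculus is a natural-deduction system for intuitionistic first-order arithmetic with equality, in de Bruijn syntax. Terms: $t::=x_n\mid 0\mid S\,t\mid t+t\mid t\cdot t$. Formulas: $\varphi::=t=t\mid\bot\mid\varphi\wedge\varphi\mid\varphi\vee\varphi\mid\varphi\to\varphi\mid\forall\varphi\mid\exists\varphi$, with $\neg\varphi:=\varphi\to\bot$. A context $\Gamma$ is a finite list of formulas; the judgment is $\Gamma\vdash\varphi$. Lifting and substitution are the standard capture-avoiding de Bruijn operations. The rules are: - the assumption rule; - equality rules (reflexivity, symmetry, transitivity, Leibniz substitution, congruence); - the distinction axioms $S\,t\ne0$ and $S\,t=S\,s\to t=s$; - the recursion equations $t+0=t$, $t+S\,s=S(t+s)$, $t\cdot0=0$, $t\cdot S\,s=t\cdot s+t$; - the induction rule: from $\Gamma\vdash\varphi[0]$ and $\Gamma\vdash\forall(\varphi\to\varphi[Sx_0])$ infer $\Gamma\vdash\forall\varphi$, where $\varphi[t]$ is substitution of $t$ for $x_0$; - the usual intuitionistic introduction and elimination rules for connectives and quantifiers; - the additional schemas, applicable in any context: $\mathrm{EM}$: $\varphi\vee\neg\varphi$; $\mathrm{LPO}$: $\exists x\,\theta(x,\vec y)\vee\forall x\,\neg\theta(x,\vec y)$; $\mathrm{MP}$: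 $\neg\neg\exists x\,\theta(x,\vec y)\to\exists x\,\theta(x,\vec y)$. Here in $\mathrm{LPO}$ and $\mathrm{MP}$ the matrix $\theta$ must be such that $\forall x(\theta(x,\vec y)\vee\neg\theta(x,\vec y))$ is derivable by a forced derivation. The ledger of a derivation is the set of entries from $\{\mathrm{EM},\mathrm{LPO},\mathrm{MP},\mathrm{QInd}\}$ contributed by its rule instances: each use of $\mathrm{EM}$, $\mathrm{LPO}$, $\mathrm{MP}$ contributes its own name, each use of induction on a formula containing a quantifier contributes $\mathrm{QInd}$, and all other rule instances contribute nothing. A derivation is forced if its ledger contains none of $\mathrm{EM},\mathrm{LPO},\mathrm{MP}$ (the entry $\mathrm{QInd}$ is allowed). Terms are interpreted in $\mathfrak{N}=(\mathbb{N},0,S,+,\cdot)$ with the usual operations on the metatheoretic natural numbers; $\models$ is the corresponding Tarski semantics. *)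

(* Defs.v *)
From Stdlib Require Import List Ensembles.
Import ListNotations.

Inductive term : Set :=
| Var (n : nat)
| Zero
| Succ (t : term)
| Add (t s : term)
| Mul (t s : term).

Inductive form : Set :=
| Eq (t s : term)
| Bot
| And (phi psi : form)
| Or (phi psi : form)
| Imp (phi psi : form)
| All (phi : form)
| Ex (phi : form).

Definition Neg (phi : form) : form := Imp phi Bot.

Fixpoint subst_term (sigma : nat -> term) (t : term) : term :=
  match t with
  | Var n => sigma n
  | Zero => Zero
  | Succ t => Succ (subst_term sigma t)
  | Add t s => Add (subst_term sigma t) (subst_term sigma s)
  | Mul t s => Mul (subst_term sigma t) (subst_term sigma s)
  end.

Definition lift_term : term -> term := subst_term (fun n => Var (S n)).

Definition up (sigma : nat -> term) : nat -> term :=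
  fun n => match n with
           | 0 => Var 0
           | S m => lift_term (sigma m)
           end.

Fixpoint subst_form (sigma : nat -> term) (phi : form) : form :=
  match phi with
  | Eq t s => Eq (subst_term sigma t) (subst_term sigma s)
  | Bot => Bot
  | And phi psi => And (subst_form sigma phi) (subst_form sigma psi)
  | Or phi psi => Or (subst_form sigma phi) (subst_form sigma psi)
  | Imp phi psi => Imp (subst_form sigma phi) (subst_form sigma psi)
  | All phi => All (subst_form (up sigma) phi)
  | Ex phi => Ex (subst_form (up sigma) phi)
  end.

Definition lift_form : form -> form := subst_form (fun n => Var (S n)).

(** [inst phi t] is phi[t] outside the scope of the binder of x_0: the
    variable x_0 is replaced by t and x_(n+1) becomes x_n. *)
Definition inst (phi : form) (t : term) : form :=
  subst_form (fun n => match n with 0 => t | S m => Var m end) phi.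

(** [step phi] is phi[S x_0] as it occurs in the induction rule, where it
    stands under the same binder as phi: x_0 is replaced by S x_0 and the
    parameters x_1, x_2, ... keep their indices.  Note that this is not
    [inst phi (Succ (Var 0))], which would identify x_0 and x_1. *)
Definition step (phi : form) : form :=
  subst_form (fun n => match n with 0 => Succ (Var 0) | S m => Var (S m) end)
    phi.

Fixpoint term_below (k : nat) (t : term) : Prop :=
  match t with
  | Var n => n < k
  | Zero => True
  | Succ t => term_below k t
  | Add t s | Mul t s => term_below k t /\ term_below k s
  end.

(** All free variables of [phi] are among x_0, ..., x_(k-1). *)
Fixpoint form_below (k : nat) (phi : form) : Prop :=
  match phi with
  | Eq t s => term_below k t /\ term_below k s
  | Bot => True
  | And phi psi | Or phi psi | Imp phi psi =>
      form_below k phi /\ form_below k psi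
  | All phi | Ex phi => form_below (S k) phi
  end.

Definition closed (phi : form) : Prop := form_below 0 phi.

Fixpoint has_quantifier (phi : form) : bool :=
  match phi with
  | Eq _ _ | Bot => false
  | And phi psi | Or phi psi | Imp phi psi =>
      orb (has_quantifier phi) (has_quantifier psi)
  | All _ | Ex _ => true
  end.

Inductive entry : Set := EM | LPO | MP | QInd.

Definition ledger : Type := Ensemble entry.

Definition no_entry : ledger := Empty_set entry.
Definition only (e : entry) : ledger := Singleton entry e.
Definition join (L M : ledger) : ledger := Union entry L M.

Definition ind_entry (phi : form) : ledger :=
  if has_quantifier phi then only QInd else no_entry.

Definition forced (L : ledger) : Prop :=
  ~ Ensembles.In entry L EM /\
  ~ Ensembles.In entry L LPO /\
  ~ Ensembles.In entry L MP.

(** [derivation G phi L] is the type of derivations of G |- phi whose ledger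
    is L.  The ledger is an index rather than a function on derivations
    because the side condition of LPO and MP refers to the ledger of another
    derivation.  That derivation only witnesses the side condition on the
    matrix theta (whose variable x is x_0): it is taken in the empty context
    and is not a premise, so it contributes nothing to the ledger. *)
Inductive derivation : list form -> form -> ledger -> Type :=
| d_assumption G phi :
    List.In phi G -> derivation G phi no_entry

| d_refl G t :
    derivation G (Eq t t) no_entry
| d_sym G t s L :
    derivation G (Eq t s) L -> derivation G (Eq s t) L
| d_trans G t s u L M :
    derivation G (Eq t s) L -> derivation G (Eq s u) M ->
    derivation G (Eq t u) (join L M)
| d_leibniz G phi t s L M :
    derivation G (Eq t s) L -> derivation G (inst phi t) M ->
    derivation G (inst phi s) (join L M)
| d_cong_succ G t t' L :
    derivation G (Eq t t') L -> derivation G (Eq (Succ t) (Succ t')) L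
| d_cong_add G t t' s s' L M :
    derivation G (Eq t t') L -> derivation G (Eq s s') M ->
    derivation G (Eq (Add t s) (Add t' s')) (join L M)
| d_cong_mul G t t' s s' L M :
    derivation G (Eq t t') L -> derivation G (Eq s s') M ->
    derivation G (Eq (Mul t s) (Mul t' s')) (join L M)

| d_succ_neq_zero G t :
    derivation G (Neg (Eq (Succ t) Zero)) no_entry
| d_succ_inj G t s :
    derivation G (Imp (Eq (Succ t) (Succ s)) (Eq t s)) no_entry

| d_add_zero G t :
    derivation G (Eq (Add t Zero) t) no_entry
| d_add_succ G t s :
    derivation G (Eq (Add t (Succ s)) (Succ (Add t s))) no_entry
| d_mul_zero G t :
    derivation G (Eq (Mul t Zero) Zero) no_entry
| d_mul_succ G t s :
    derivation G (Eq (Mul t (Succ s)) (Add (Mul t s) t)) no_entry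

| d_ind G phi L M :
    derivation G (inst phi Zero) L ->
    derivation G (All (Imp phi (step phi))) M ->
    derivation G (All phi) (join (ind_entry phi) (join L M))

| d_bot_elim G phi L :
    derivation G Bot L -> derivation G phi L
| d_and_intro G phi psi L M :
    derivation G phi L -> derivation G psi M ->
    derivation G (And phi psi) (join L M)
| d_and_elim_l G phi psi L :
    derivation G (And phi psi) L -> derivation G phi L
| d_and_elim_r G phi psi L :
    derivation G (And phi psi) L -> derivation G psi L
| d_or_intro_l G phi psi L :
    derivation G phi L -> derivation G (Or phi psi) L
| d_or_intro_r G phi psi L :
    derivation G psi L -> derivation G (Or phi psi) L
| d_or_elim G phi psi chi L M N :
    derivation G (Or phi psi) L ->
    derivation (phi :: G) chi M -> derivation (psi :: G) chi N ->
    derivation G chi (join L (join M N))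
| d_imp_intro G phi psi L :
    derivation (phi :: G) psi L -> derivation G (Imp phi psi) L
| d_imp_elim G phi psi L M :
    derivation G (Imp phi psi) L -> derivation G phi M ->
    derivation G psi (join L M)
| d_all_intro G phi L :
    derivation (map lift_form G) phi L -> derivation G (All phi) L
| d_all_elim G phi t L :
    derivation G (All phi) L -> derivation G (inst phi t) L
| d_ex_intro G phi t L :
    derivation G (inst phi t) L -> derivation G (Ex phi) L
| d_ex_elim G phi psi L M :
    derivation G (Ex phi) L ->
    derivation (phi :: map lift_form G) (lift_form psi) M ->
    derivation G psi (join L M)

| d_em G phi :
    derivation G (Or phi (Neg phi)) (only EM)
| d_lpo G theta D :
    derivation [] (All (Or theta (Neg theta))) D -> forced D ->
    derivation G (Or (Ex theta) (All (Neg theta))) (only LPO)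
| d_mp G theta D :
    derivation [] (All (Or theta (Neg theta))) D -> forced D ->
    derivation G (Imp (Neg (Neg (Ex theta))) (Ex theta)) (only MP).

Fixpoint eval (rho : nat -> nat) (t : term) : nat :=
  match t with
  | Var n => rho n
  | Zero => 0
  | Succ t => S (eval rho t)
  | Add t s => eval rho t + eval rho s
  | Mul t s => eval rho t * eval rho s
  end.

Definition scons (a : nat) (rho : nat -> nat) : nat -> nat :=
  fun n => match n with
           | 0 => a
           | S m => rho m
           end.

Fixpoint sat (rho : nat -> nat) (phi : form) : Prop :=
  match phi with
  | Eq t s => eval rho t = eval rho s
  | Bot => False
  | And phi psi => sat rho phi /\ sat rho psi
  | Or phi psi => sat rho phi \/ sat rho psi
  | Imp phi psi => sat rho phi -> sat rho psi
  | All phi => forall a : nat, sat (scons a rho) phi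
  | Ex phi => exists a : nat, sat (scons a rho) phi
  end.

(** For closed [phi] the truth value does not depend on the assignment. *)
Definition models (phi : form) : Prop := forall rho : nat -> nat, sat rho phi.

(* Main.v *)
Require Import Defs.
From Stdlib Require Import List Ensembles.
Import ListNotations.

(** The theorem is soundness of intuitionistic arithmetic for Tarski
    semantics, in a form that is itself intuitionistically valid.  [sat] reads
    each connective as the same connective of the metatheory, so every logical
    rule of the calculus is justified by the metatheoretic rule of the same
    name, and induction on an arbitrary formula, with or without quantifiers,
    by induction on [nat].  The schemas EM, LPO and MP are the only ones whose
    validity could call for more than this, and a forced ledger excludes them.

    The proof is by induction on the derivation, with the assertion
    strengthened from closed theorems to open sequents under all assignments
    ([forced_sound]): premises have hypotheses and free variables even when
    the conclusion has none.  Two facts carry it.  Ledgers only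
    grow from premises to conclusion, so all premises of a forced derivation
    are forced ([forced_join]).  And substituting in a formula amounts to
    changing the assignment ([sat_subst]), which explains every rule that
    mentions a substitution or a lifting. *)

Lemma forced_join (L M : ledger) :
  forced (join L M) -> forced L /\ forced M.
Proof.
  intros (Hem & Hlpo & Hmp).
  split; (split; [|split]); intro H;
    (apply Hem + apply Hlpo + apply Hmp);
    solve [apply Union_introl; exact H | apply Union_intror; exact H].
Qed.

Lemma eval_subst (sigma : nat -> term) (rho rho' : nat -> nat) (t : term) :
  (forall n, eval rho (sigma n) = rho' n) ->
  eval rho (subst_term sigma t) = eval rho' t.
Proof.
  intro H; induction t; simpl; auto.
Qed.

Lemma eval_up (sigma : nat -> term) (rho rho' : nat -> nat) (a : nat) :
  (forall n, eval rho (sigma n) = rho' n) ->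
  forall n, eval (scons a rho) (up sigma n) = scons a rho' n.
Proof.
  intros H [|n]; simpl; [reflexivity|].
  rewrite <- H; apply eval_subst; reflexivity.
Qed.

(** The assignment [rho'] is only required to agree pointwise with
    [fun n => eval rho (sigma n)].  Under a binder the two assignments are
    extensionally but not definitionally equal, so this form lets the
    induction pass through quantifiers without function extensionality. *)
Lemma sat_subst (phi : form) (sigma : nat -> term) (rho rho' : nat -> nat) :
  (forall n, eval rho (sigma n) = rho' n) ->
  sat rho (subst_form sigma phi) <-> sat rho' phi.
Proof.
  revert sigma rho rho'.
  induction phi as [t s| |phi IH1 psi IH2|phi IH1 psi IH2|phi IH1 psi IH2
                   |phi IH|phi IH]; intros sigma rho rho' H; simpl.
  - rewrite !(eval_subst sigma rho rho') by exact H; reflexivity.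
  - reflexivity.
  - rewrite (IH1 _ _ _ H), (IH2 _ _ _ H); reflexivity.
  - rewrite (IH1 _ _ _ H), (IH2 _ _ _ H); reflexivity.
  - rewrite (IH1 _ _ _ H), (IH2 _ _ _ H); reflexivity.
  - split; intros Hall a; apply (IH _ _ _ (eval_up _ _ _ a H)); apply Hall.
  - split; intros [a Ha]; exists a; apply (IH _ _ _ (eval_up _ _ _ a H));
      exact Ha.
Qed.

Lemma sat_inst (rho : nat -> nat) (phi : form) (t : term) :
  sat rho (inst phi t) <-> sat (scons (eval rho t) rho) phi.
Proof.
  apply sat_subst; intros [|n]; reflexivity.
Qed.

Lemma sat_step (rho : nat -> nat) (phi : form) (a : nat) :
  sat (scons a rho) (step phi) <-> sat (scons (S a) rho) phi.
Proof.
  apply sat_subst; intros [|n]; reflexivity.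
Qed.

Lemma sat_lift (rho : nat -> nat) (phi : form) (a : nat) :
  sat (scons a rho) (lift_form phi) <-> sat rho phi.
Proof.
  apply sat_subst; reflexivity.
Qed.

Lemma Forall_sat_lift (rho : nat -> nat) (G : list form) (a : nat) :
  Forall (sat rho) G -> Forall (sat (scons a rho)) (map lift_form G).
Proof.
  intro H; apply Forall_map; revert H; apply Forall_impl.
  intro phi; apply sat_lift.
Qed.

(** The assignment is quantified inside the induction because the quantifier
    rules use the induction hypothesis at [scons a rho]. *)
Lemma forced_sound (G : list form) (phi : form) (L : ledger) :
  derivation G phi L -> forced L ->
  forall rho, Forall (sat rho) G -> sat rho phi.
Proof.
  intro d; induction d; intro HL;
    repeat match goal with
           | H : forced (join _ _) |- _ =>
               apply forced_join in H; destruct H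
           end;
    repeat match goal with
           | IH : forced ?M -> _, H : forced ?M |- _ => specialize (IH H)
           end;
    intros rho HG; simpl in *.
  - revert phi i; apply Forall_forall; exact HG.
  - reflexivity.
  - symmetry; auto.
  - transitivity (eval rho s); auto.
  - apply sat_inst; rewrite <- (IHd1 rho HG); apply sat_inst; auto.
  - f_equal; auto.
  - f_equal; auto.
  - f_equal; auto.
  - discriminate.
  - intro E; injection E; auto.
  - symmetry; apply plus_n_O.
  - symmetry; apply plus_n_Sm.
  - symmetry; apply mult_n_O.
  - symmetry; apply mult_n_Sm.
  - intro a; induction a as [|a IHa].
    + apply (sat_inst rho phi Zero); auto.
    + apply sat_step, IHd2; assumption.
  - destruct (IHd rho HG).
  - auto.
  - apply IHd; exact HG.
  - apply IHd; exact HG.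
  - auto.
  - auto.
  - destruct (IHd1 rho HG); auto.
  - auto.
  - apply (IHd1 rho HG); auto.
  - intro a; apply IHd, Forall_sat_lift, HG.
  - apply sat_inst, IHd, HG.
  - exists (eval rho t); apply sat_inst; auto.
  - destruct (IHd1 rho HG) as [a Ha].
    apply (sat_lift rho psi a), IHd2.
    constructor; [exact Ha|apply Forall_sat_lift, HG].
  - destruct (proj1 HL); constructor.
  - destruct (proj1 (proj2 HL)); constructor.
  - destruct (proj2 (proj2 HL)); constructor.
Qed.

Theorem theorem3p2 (phi : form) (L : ledger) (d : derivation [] phi L)
  (hforced : forced L) (hclosed : closed phi) : models phi.
Proof.
  intro rho.
  exact (forced_sound [] phi L d hforced rho (Forall_nil _)).
Qed.
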